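(* Let $\Theta=\mathbb{R}^d$. Let $\{\phi_n\}_{n\in\mathbb{N}}$ be density functions on $\mathbb{R}^d$, $\{s_n\}$ positive numbers, and $\phi$ a density, such that: (1) each $\phi_n$ is log-concave; (2) $s_n\to\infty$; (3) $\phi_n(s_n\,\cdot)\to\phi(\cdot)$ in distribution; (4) $\phi$ is continuous on its support; (5) for every compact $\mathcal{X}\subset\Theta$, $\inf_{x\in\mathcal{X}}\phi(x)>0$. Fix a symmetric proposal kernel $L$ on $\Theta$ and define $L_n(x,A)=L(s_nx,s_nA)$. Let $K$ be the Metropolis-Hastings kernel with proposal $L$ and target $\phi$, and $K_n$ the Metropolis-Hastings kernel with proposal $L_n$ and target $\phi_n$. Fix $T\in\mathbb{N}$ and $x\in\Theta$, and let $\{X_t\}_{t=0}^T$, $\{Y_t\}_{t=0}^T$ be Markov chains driven by $K_n$ and $K$ respectively, started at $X_0=x/s_n$ and $Y_0=x$. Then for every measurable $A\subset\Theta^{T+1}$, $$\lim_{N_0\to\infty}\sup_{n\ge N_0}\big|\mathbb{P}[(s_nX_0,\dots,s_nX_T)\in A]-\mathbb{P}[(Y_0,\dots,Y_T)\in A]\big|=0.$$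
   Context: The Metropolis-Hastings kernel with symmetric proposal $Q$ and target density $g$: from $x$ draw $y\sim Q(x,\cdot)$ and move to $y$ with probability $\min(1,g(y)/g(x))$, otherwise stay at $x$.
   Formalization: Hypothesis (3) is read as: if X has density φ_n, the law of s_nX (density s_n^{-d}φ_n(·/s_n)) converges weakly to φ; taken literally φ_n(s_n·) has mass s_n^{-d}→0, and its normalization makes the claim false. *)

(* Defs.v *)
From HB Require Import structures.
From mathcomp Require Import all_boot all_order all_algebra.
From mathcomp Require Import all_classical all_reals all_analysis.
Set Implicit Arguments. Unset Strict Implicit. Unset Printing Implicit Defensive.
Import Order.TTheory GRing.Theory Num.Theory.
Import numFieldNormedType.Exports.
Local Open Scope classical_set_scope.
Local Open Scope ring_scope.

(* The state space Theta = R^d is represented by d.-tuple R, which carries the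
   product (= Borel) sigma-algebra of mathcomp-analysis (g_sigma_preimage of
   the coordinates); Theta^(T+1) is (T.+1).-tuple (d.-tuple R), again with
   the product sigma-algebra. *)

Section Defs.
Variables (R : realType) (d : nat).
Local Notation Theta := (d.-tuple R).

Definition scale (s : R) (x : Theta) : Theta := [tuple s * tnth x i | i < d].
Definition cvx (l : R) (x y : Theta) : Theta :=
  [tuple l * tnth x i + (1 - l) * tnth y i | i < d].

(* Lebesgue integral on R^d of a function with values in \bar R, defined as
   the iterated one-dimensional Lebesgue integral (Fubini/Tonelli). *)
Fixpoint leb_int (n : nat) : (n.-tuple R -> \bar R) -> \bar R :=
  match n return (n.-tuple R -> \bar R) -> \bar R with
  | 0 => fun f => f [tuple]
  | m.+1 => fun f =>
      (\int[@lebesgue_measure R]_(r in setT)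
         leb_int (fun t : m.-tuple R => f (cons_tuple r t)))%E
  end.

Definition lebesgue_int (f : Theta -> \bar R) : \bar R := leb_int f.

Definition is_density (f : Theta -> R) : Prop :=
  [/\ forall x, 0 <= f x, measurable_fun [set: Theta] f &
      lebesgue_int (fun x => (f x)%:E) = 1%E].

Definition log_concave (f : Theta -> R) : Prop :=
  forall (x y : Theta) (l : R), 0 < l < 1 ->
    f x `^ l * f y `^ (1 - l) <= f (cvx l x y).

(* topology on R^d, transported from the normed space 'rV[R]_d *)
Definition toRow (x : Theta) : 'rV[R]_d := \row_i tnth x i.
Definition ofRow (v : 'rV[R]_d) : Theta := [tuple v ord0 i | i < d].

Definition Rd_continuous (h : Theta -> R) : Prop := continuous (h \o ofRow).
Definition Rd_compact (X : set Theta) : Prop := compact (toRow @` X).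

Definition support (f : Theta -> R) : set Theta := [set x | 0 < f x].
Definition continuous_on_support (f : Theta -> R) : Prop :=
  {within toRow @` support f, continuous (f \o ofRow)}.

(* "phi_n(s_n .) -> phi in distribution": the law of s_n X, X ~ phi_n,
   converges weakly to the law with density phi (bounded continuous tests). *)
Definition scaled_conv_in_distribution (phin : nat -> Theta -> R)
    (s : nat -> R) (phi : Theta -> R) : Prop :=
  forall h : Theta -> R, Rd_continuous h ->
    (exists M : R, forall x, `|h x| <= M) ->
    (fun n => lebesgue_int (fun x => (h (scale (s n) x) * phin n x)%:E))
      @ \oo --> lebesgue_int (fun x => (h x * phi x)%:E).

(* symmetric proposal kernel: reversible w.r.t. Lebesgue measure,
   L(x,dy) dx = L(y,dx) dy *)
Definition symmetric_kernel (L : R.-pker Theta ~> Theta) : Prop :=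
  forall A B : set Theta, measurable A -> measurable B ->
    lebesgue_int (fun x => ((\1_A x)%:E * L x B)%E) =
    lebesgue_int (fun x => ((\1_B x)%:E * L x A)%E).

(* A proposal is given through its integration functional
   Qint x h = \int h(y) Q(x,dy). *)
Definition Lint (L : R.-pker Theta ~> Theta) (x : Theta) (h : Theta -> \bar R)
  : \bar R := (\int[L x]_y h y)%E.

(* L_n(x, A) = L(s x, s A): a draw y ~ L_n(x,.) is y = z/s with z ~ L(s x,.),
   so \int h dL_n(x,.) = \int h(z/s) L(s x, dz). *)
Definition Ln_set (L : R.-pker Theta ~> Theta) (s : R) (x : Theta)
  (A : set Theta) : \bar R := L (scale s x) (scale s @` A).
Definition Lnint (L : R.-pker Theta ~> Theta) (s : R) (x : Theta)
  (h : Theta -> \bar R) : \bar R :=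
  (\int[L (scale s x)]_z h (scale s^-1 z))%E.

(* Metropolis-Hastings acceptance probability min(1, g(y)/g(x))
   (convention: g(y)/0 = +oo, i.e. accept with probability 1 if g(x) = 0) *)
Definition accept (g : Theta -> R) (x y : Theta) : R :=
  if g x == 0 then 1 else Num.min 1 (g y / g x).

(* integral of h against the MH kernel K(x, .) with proposal Qint, target g:
   K(x,dy) = accept(x,y) Q(x,dy) + (1 - \int accept(x,y) Q(x,dy)) delta_x(dy) *)
Definition MHint (Qint : Theta -> (Theta -> \bar R) -> \bar R)
    (g : Theta -> R) (x : Theta) (h : Theta -> \bar R) : \bar R :=
  (Qint x (fun y => (accept g x y)%:E * h y) +
   (1 - Qint x (fun y => (accept g x y)%:E)) * h x)%E.

(* E[f(X_0,...,X_T)] for the MH chain started at X_0 = x *)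
Fixpoint pathE (Qint : Theta -> (Theta -> \bar R) -> \bar R) (g : Theta -> R)
    (T : nat) : Theta -> (T.+1.-tuple Theta -> \bar R) -> \bar R :=
  match T return Theta -> (T.+1.-tuple Theta -> \bar R) -> \bar R with
  | 0 => fun x f => f [tuple x]
  | T'.+1 => fun x f =>
      MHint Qint g x (fun y => pathE Qint g y (fun p => f (cons_tuple x p)))
  end.

End Defs.

(* Main.v *)
Require Import Defs.
From HB Require Import structures.
From mathcomp Require Import all_boot all_order all_algebra.
From mathcomp Require Import all_classical all_reals all_analysis measurable_realfun.
From mathcomp Require Import ring lra.
Import Order.TTheory GRing.Theory Num.Theory.
Import numFieldNormedType.Exports.
Local Open Scope classical_set_scope.
Local Open Scope ring_scope.

(* The process [s_n X_t] is the Metropolis-Hastings chain with proposal [L] and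
   target [p_n], the density of [s_n Z] for [Z] of density [phin n]. The heart of the
   matter is that [p_n -> phi] pointwise. Testing the weak convergence against
   tent functions gives, in any small cube, points where [p_n] is almost [phi].
   Choosing such points near the corners of a cube around [x],
   quasi-concavity bounds [p_n] from below on a smaller cube. For the upper
   bound, if [p_n q <= phi x + e] with [q] close to [x], then
   [p_n x * p_n (2 q - x) <= (p_n q) ^+ 2] by log-concavity, and the second
   factor is already bounded from below. The acceptance probabilities then
   converge pointwise, and dominated convergence along [L] carries the limit
   through each of the [T] steps. *)

(** * Convexity *)

Section convexity.
Context {R : realType} {d : nat}.
Implicit Types (S : set (d.-tuple R)) (f : d.-tuple R -> R) (x y q : d.-tuple R).

Definition convex_subset S :=
  forall x y (l : R), 0 < l < 1 -> S x -> S y -> S (cvx l x y).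

(* The coordinates are equalised with those of [y] one after the other. *)
Lemma convex_meets_orthants S y : convex_subset S ->
  (forall o : {ffun 'I_d -> bool}, exists2 q, S q &
     forall i, if o i then tnth y i <= tnth q i else tnth q i <= tnth y i) ->
  S y.
Proof.
move=> cS orth.
(* Invariant: the first [k] coordinates agree with those of [y], while the others still lie in any
   prescribed orthant [o]. *)
suff H k : (k <= d)%N -> forall o : {ffun 'I_d -> bool}, exists2 q, S q &
    forall i : 'I_d, if (i < k)%N then tnth q i = tnth y i else
      if o i then tnth y i <= tnth q i else tnth q i <= tnth y i.
  have [q Sq qy] := H d (leqnn d) [ffun=> true].
  suff <- : q = y by [].
  by apply: eq_from_tnth => i; have := qy i; rewrite ltn_ord.
elim: k => [_ o|k IH kd o]; first exact: orth.
pose ik := Ordinal kd.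
(* Two orthants that prescribe opposite sides at coordinate [ik] and follow [o] elsewhere: the
   segment between the two points crosses the level of [y] there. *)
have [q1 Sq1 H1] := IH (ltnW kd) [ffun i => (i == ik) || o i].
have [q0 Sq0 H0] := IH (ltnW kd) [ffun i => (i != ik) && o i].
have := H1 ik; have := H0 ik; rewrite !ffunE eqxx /= ltnn => y0 y1.
have E (i : 'I_d) : (i < k.+1)%N = (i < k)%N || (i == ik).
  by rewrite ltnS leq_eqVlt orbC.
have K1 i : i != ik -> if (i < k)%N then tnth q1 i = tnth y i else
      if o i then tnth y i <= tnth q1 i else tnth q1 i <= tnth y i.
  by move=> nik; have := H1 i; rewrite ffunE (negbTE nik).
have K0 i : i != ik -> if (i < k)%N then tnth q0 i = tnth y i else
      if o i then tnth y i <= tnth q0 i else tnth q0 i <= tnth y i.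
  by move=> nik; have := H0 i; rewrite ffunE nik.
(* Equality at [ik] is settled first, because convexity is available only for weights strictly
   between 0 and 1. *)
have [y0E|y0N] := eqVneq (tnth q0 ik) (tnth y ik).
  exists q0 => // i; rewrite E; have [->|nik] := eqVneq i ik.
    by rewrite orbT.
  by rewrite orbF; exact: K0.
have [y1E|y1N] := eqVneq (tnth q1 ik) (tnth y ik).
  exists q1 => // i; rewrite E; have [->|nik] := eqVneq i ik.
    by rewrite orbT.
  by rewrite orbF; exact: K1.
have a0 : tnth q0 ik < tnth y ik by rewrite lt_neqAle y0N.
have a1 : tnth y ik < tnth q1 ik by rewrite lt_neqAle eq_sym y1N.
(* The weight at which coordinate [ik] of [cvx l q1 q0] equals that of [y]. *)
pose l := (tnth y ik - tnth q0 ik) / (tnth q1 ik - tnth q0 ik).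
have D0 : 0 < tnth q1 ik - tnth q0 ik by lra.
have l01 : 0 < l < 1.
  have ya : 0 < tnth y ik - tnth q0 ik by lra.
  by rewrite /l (divr_gt0 ya D0)/= ltr_pdivrMr// mul1r; lra.
exists (cvx l q1 q0); first exact: cS.
move=> i; rewrite E; have [->|nik] := eqVneq i ik.
  rewrite orbT tnth_mktuple.
  have -> : l * tnth q1 ik + (1 - l) * tnth q0 ik =
      l * (tnth q1 ik - tnth q0 ik) + tnth q0 ik by ring.
  by rewrite /l divfK ?gt_eqF// subrK.
rewrite orbF tnth_mktuple; have := K1 i nik; have := K0 i nik.
have /andP[l0 l1] := l01.
case: ifP => _; first by move=> -> ->; ring.
by case: ifP => _ h0 h1; nra.
Qed.

(** For positive [m], the powers of [m] with exponents [l] and [1 - l] multiply back to [m].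
    Otherwise the set is the whole space, by nonnegativity. *)
Lemma log_concave_superlevel f (m : R) : (forall x, 0 <= f x) ->
  log_concave f -> convex_subset [set x | m <= f x].
Proof.
move=> f0 fl x y l l01 /= mx my; have [m0|m0] := leP m 0.
  exact: le_trans (f0 _).
apply: le_trans (fl x y l l01); have /andP[l0 l1] := l01.
have -> : m = m `^ l * m `^ (1 - l).
  by rewrite -powRD ?(gt_eqF m0) ?implybT// addrC subrK powRr1// ltW.
by apply: ler_pM; rewrite ?powR_ge0//; apply: ge0_ler_powR;
  rewrite ?nnegrE ?subr_ge0 ?f0 ?(ltW m0) ?(ltW l0) ?(ltW l1).
Qed.

(** Log-concavity with weight 1/2, squared to remove the square roots. *)
Lemma log_concave_midpoint f x y : (forall x, 0 <= f x) ->
  log_concave f -> f x * f y <= f (cvx 2^-1 x y) ^+ 2.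
Proof.
move=> f0 fl; have h : 0 < (2^-1 : R) < 1 by lra.
have := fl x y _ h; have -> : 1 - 2^-1 = 2^-1 :> R by lra.
move=> H.
have : (f x `^ 2^-1 * f y `^ 2^-1) ^+ 2 <= f (cvx 2^-1 x y) ^+ 2.
  by rewrite ler_pXn2r// ?nnegrE ?mulr_ge0// powR_ge0.
by rewrite !powR12_sqrt// exprMn !sqr_sqrtr.
Qed.

Lemma scale_cvx (s l : R) x y : scale s (cvx l x y) = cvx l (scale s x) (scale s y).
Proof. by apply: eq_from_tnth => i; rewrite !tnth_mktuple; ring. Qed.

Lemma scaleK (s : R) : s != 0 -> cancel (@scale R d s^-1) (scale s).
Proof. by move=> s0 x; apply: eq_from_tnth => i; rewrite !tnth_mktuple mulVKf. Qed.

Lemma log_concave_scale f (s : R) : log_concave f -> log_concave (f \o scale s).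
Proof. by move=> fl x y l l01 /=; rewrite scale_cvx; exact: fl. Qed.

Lemma log_concaveZ f (k : R) : (forall x, 0 <= f x) -> 0 <= k ->
  log_concave f -> log_concave (fun x => k * f x).
Proof.
move=> f0 k0 fl x y l /[dup] l01 /andP[l0 l1]; rewrite !powRM// mulrACA.
rewrite -powRD; last by rewrite addrC subrK oner_eq0.
by rewrite addrC subrK powRr1// ler_wpM2l// fl.
Qed.

End convexity.

(** * Integrals of tent functions *)

Section bump_integrals.
Context {R : realType}.
Local Notation mu := (@lebesgue_measure R).
Local Open Scope ereal_scope.

Import HBNNSimple.

(** Both sides are suprema over simple functions below the integrand, so monotonicity holds without
    measurability. This allows comparing iterated integrals without studying their inner
    integrals. *)
Lemma ge0_le_integralT d (T : measurableType d) (m : {measure set T -> \bar R})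
    (f g : T -> \bar R) :
  (forall x, 0 <= f x) -> (forall x, f x <= g x) ->
  \int[m]_x f x <= \int[m]_x g x.
Proof.
move=> f0 fg; have g0 x : 0 <= g x by exact: le_trans (fg x).
rewrite !ge0_integralTE//; apply: ereal_sup_le => _ [h /= hf <-].
by exists h => //= x; exact: le_trans (fg x).
Qed.

Lemma leb_int_ge0 n (f : n.-tuple R -> \bar R) :
  (forall x, 0 <= f x) -> 0 <= leb_int f.
Proof. by elim: n f => [|n IH] f f0 //=; apply: integral_ge0 => r _; exact: IH. Qed.

Lemma ge0_le_leb_int n (f g : n.-tuple R -> \bar R) :
  (forall x, 0 <= f x) -> (forall x, f x <= g x) -> leb_int f <= leb_int g.
Proof.
elim: n f g => [|n IH] f g f0 fg //=.
apply: ge0_le_integralT => r; first exact: leb_int_ge0.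
exact: IH.
Qed.

(** [s] times the image of Lebesgue measure under the affine map gives half-open intervals their
    length, and this determines Lebesgue measure. *)
Lemma lebesgue_measure_affine (s c : R) (A : set R) : (0 < s)%R -> measurable A ->
  s%:E * mu ((fun t => s * t - c)%R @^-1` A) = mu A.
Proof.
move=> s0 mA.
pose a t : measurableTypeR R := (s * (t : measurableTypeR R) - c)%R.
have ms : measurable_fun setT a.
  by apply: measurable_funD => //; exact: measurable_funM.
pose ps : {measure set (measurableTypeR R) -> \bar R} :=
  mscale (NngNum (ltW s0)) (pushforward mu a).
apply/esym; transitivity (ps ms A); last by [].
apply: lebesgue_measure_unique => // _ [[b e]] _ <-.
rewrite -[RHS]/(s%:E * mu ((fun t => s * t - c)%R @^-1` `]b, e])).
have -> : (fun t => s * t - c)%R @^-1` `]b, e] =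
    `]((b + c) / s)%R, ((e + c) / s)%R]%classic.
  apply/seteqP; split => x /=; rewrite !in_itv/= ltr_pdivrMr// ler_pdivlMr//;
  by move=> /andP[h1 h2]; apply/andP; split; lra.
rewrite !lebesgue_measure_itv/= !lte_fin ltr_pM2r ?invr_gt0// ltrD2r.
case: ifPn => _; last by rewrite mule0.
by rewrite -!EFinD -EFinM; congr EFin; field; rewrite gt_eqF.
Qed.

Lemma ge0_integral_affine (f : R -> \bar R) (s c : R) : (0 < s)%R ->
  measurable_fun [set: R] f -> (forall x, 0 <= f x) ->
  \int[mu]_t f (s * t - c)%R = s^-1%:E * \int[mu]_t f t.
Proof.
move=> s0 mf f0.
pose a t : measurableTypeR R := (s * (t : measurableTypeR R) - c)%R.
have ms : measurable_fun setT a.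
  by apply: measurable_funD => //; exact: measurable_funM.
have s'0 : (0 <= s^-1)%R by rewrite invr_ge0 ltW.
rewrite -(ge0_integral_mscale _ _ (NngNum s'0))//.
transitivity (\int[pushforward mu a]_t f t).
  by rewrite ge0_integral_pushforward.
apply: eq_measure_integral => A mA _.
rewrite -[RHS]/(s^-1%:E * mu A).
rewrite -(lebesgue_measure_affine s c)// muleA -EFinM mulVf ?gt_eqF//.
by rewrite mul1e.
Qed.

(** For positive [r], a hat of height and half-width [r]: a continuous substitute for the indicator
    of an interval, hence admissible as a test function. *)
Definition tent (r t : R) : R := Num.max 0%R (r - `|t|)%R.

Lemma tent_ge0 r t : (0 <= tent r t)%R.
Proof. by rewrite /tent le_max lexx. Qed.

Lemma tent_le r t : (0 < r)%R -> (tent r t <= r)%R.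
Proof. by move=> r0; rewrite /tent ge_max ltW//= gerBl. Qed.

Lemma tent_neq0 r t : tent r t != 0%R -> (`|t| < r)%R.
Proof.
apply: contraTT; rewrite -leNgt => rt; rewrite negbK /tent max_l//.
by rewrite subr_le0.
Qed.

Lemma continuous_tent r : continuous (tent r).
Proof.
move=> t; rewrite [tent r](_ : _ = cst 0%R \max (fun t => r - `|t|)%R)//.
apply: (@continuous_max R R (cst 0%R) (fun t => r - `|t|)%R); first exact: cvg_cst.
by apply: cvgB; [exact: cvg_cst|exact: norm_continuous].
Qed.

Lemma measurable_tent r : measurable_fun setT (tent r).
Proof. by apply: continuous_measurable_fun; exact: continuous_tent. Qed.

(** The tent lies above [r / 2] on the half-size interval and below [r] on the full one. Later, [J]
    is a common positive factor that cancels. *)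
Lemma integral_tent (r : R) : (0 < r)%R ->
  exists2 J : R, (0 < J)%R & \int[mu]_t (tent r t)%:E = J%:E.
Proof.
move=> r0.
have hi : \int[mu]_t (tent r t)%:E <= \int[mu]_t (r * \1_(`[-r, r]) t)%:E.
  apply: ge0_le_integralT => t; rewrite lee_fin ?tent_ge0// indicE.
  have [tr|tr] := boolP (t \in _); first by rewrite mulr1 tent_le.
  rewrite mulr0; have [->//|/tent_neq0] := eqVneq (tent r t) 0%R.
  rewrite ltr_norml => /andP[h1 h2]; case/negP: tr.
  by rewrite inE/= in_itv/= !ltW.
have lo : \int[mu]_t (r / 2 * \1_(`[(- (r / 2))%R, (r / 2)%R]) t)%:E <=
    \int[mu]_t (tent r t)%:E.
  apply: ge0_le_integralT => t; rewrite lee_fin.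
    by rewrite mulr_ge0// divr_ge0// ltW.
  rewrite indicE; have [|] := boolP (t \in _); last by rewrite mulr0 tent_ge0.
  rewrite inE/= in_itv/= => h.
  have : (`|t| <= r / 2)%R by rewrite ler_norml.
  by rewrite /tent le_max mulr1 => ?; apply/orP; right; lra.
have E (k a b : R) : (0 <= k)%R ->
    \int[mu]_t (k * \1_(`[a, b]) t)%:E = k%:E * mu `[a, b]%classic.
  move=> k0; under eq_integral do rewrite EFinM.
  rewrite ge0_integralZl//; first by rewrite integral_indic// setIT.
  by apply/measurable_EFinP; exact: measurable_indic.
have r20 : (0 <= r / 2)%R by rewrite divr_ge0// ltW.
move: hi lo; rewrite (E _ _ _ (ltW r0)) (E _ _ _ r20).
rewrite !lebesgue_measure_itv/= !lte_fin.
rewrite ifT; last by lra.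
rewrite ifT; last by lra.
rewrite -!EFinD -!EFinM => hi lo.
have fin : \int[mu]_t (tent r t)%:E \is a fin_num.
  rewrite ge0_fin_numE; first exact: le_lt_trans hi (ltry _).
  by apply: integral_ge0 => t _; rewrite lee_fin tent_ge0.
exists (fine (\int[mu]_t (tent r t)%:E)); last by rewrite fineK.
rewrite -lte_fin fineK//; apply: lt_le_trans lo; rewrite lte_fin.
by nra.
Qed.

(** Tonelli, one coordinate at a time: each contributes [s^-1 * J]. The constant [k] absorbs the
    tent factor of the outer coordinate in the induction. *)
Lemma leb_int_prod_tent r J n (s k : R) (c : 'I_n -> R) : (0 < s)%R -> (0 <= k)%R ->
  \int[mu]_t (tent r t)%:E = J%:E ->
  leb_int (fun z : n.-tuple R => (k * \prod_i tent r (s * tnth z i - c i))%:E) =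
  (k * (s^-1 * J) ^+ n)%:E.
Proof.
move=> s0 + HJ; elim: n k c => [|n IH] k c k0 /=; first by rewrite big_ord0 expr0.
transitivity (\int[mu]_t ((k * (s^-1 * J) ^+ n)%:E * (tent r (s * t - c ord0))%:E)).
  apply: eq_integral => t _.
  transitivity (leb_int (fun z : n.-tuple R => (k * tent r (s * t - c ord0) *
     \prod_i tent r (s * tnth z i - c (lift ord0 i)))%:E)).
    congr leb_int; apply/funext => z; congr EFin.
    rewrite big_ord_recl mulrA; congr (_ * _)%R.
    by apply: eq_bigr => i _; rewrite tnthS.
  by rewrite IH ?mulr_ge0 ?tent_ge0// -EFinM mulrAC.
have J0 : (0 <= J)%R.
  by rewrite -lee_fin -HJ; apply: integral_ge0 => t _; rewrite lee_fin tent_ge0.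
have me : measurable_fun setT (fun t => (tent r (s * t - c ord0))%:E).
  apply/measurable_EFinP; apply: (measurableT_comp (measurable_tent r)).
  by apply: measurable_funD => //; exact: measurable_funM.
rewrite ge0_integralZl//; first last.
- by rewrite lee_fin mulr_ge0// exprn_ge0// mulr_ge0// invr_ge0 ltW.
- by move=> t _; rewrite lee_fin tent_ge0.
rewrite (ge0_integral_affine (fun t => (tent r t)%:E))//; first last.
- by move=> t; rewrite lee_fin tent_ge0.
- by apply/measurable_EFinP; exact: measurable_tent.
by rewrite HJ -!EFinM exprS; congr EFin; ring.
Qed.

End bump_integrals.

(** * Pointwise convergence of the rescaled densities *)

Section pointwise_convergence.
Context {R : realType} {d : nat}.
Local Notation Theta := (d.-tuple R).
Implicit Types (x y z q : Theta).

Lemma cvge_near_gt (u : nat -> \bar R) (l b : \bar R) :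
  u @ \oo --> l -> (b < l)%E -> \forall n \near \oo, (b < u n)%E.
Proof.
move=> ul bl; apply: (ul [set y | (b < y)%E]).
by apply: open_nbhs_nbhs; split => //; exact: open_ereal_gt_ereal.
Qed.

Lemma cvge_near_lt (u : nat -> \bar R) (l b : \bar R) :
  u @ \oo --> l -> (l < b)%E -> \forall n \near \oo, (u n < b)%E.
Proof.
move=> ul bl; apply: (ul [set y | (y < b)%E]).
by apply: open_nbhs_nbhs; split => //; exact: open_ereal_lt_ereal.
Qed.

(** The open ball of the sup norm. The centre is a function of the index, so that corners can be
    given by cases. *)
Definition cube (c : 'I_d -> R) (r : R) : set Theta :=
  [set z | forall i, `|tnth z i - c i| < r].

Lemma toRowK : cancel (@toRow R d) (@ofRow R d).
Proof. by move=> x; apply: eq_from_tnth => i; rewrite tnth_mktuple mxE. Qed.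

Lemma Rd_continuous_cube (f : Theta -> R) x e : Rd_continuous f -> 0 < e ->
  exists2 r, 0 < r & forall y, cube (tnth x) r y -> `|f y - f x| < e.
Proof.
move=> fc e0; have /cvgrPdist_lt /(_ e e0) := fc (toRow x).
move=> /nbhs_ballP[r /= r0 rf]; exists r => // y yr.
have := rf (toRow y); rewrite /= !toRowK distrC; apply; split => // i j.
by rewrite !mxE /ball/= distrC; exact: yr.
Qed.

(** The support is the whole space, so continuity within it is plain continuity. *)
Lemma continuous_on_support_pos (f : Theta -> R) :
  (forall x, 0 < f x) -> continuous_on_support f -> Rd_continuous f.
Proof.
move=> f0; rewrite /continuous_on_support.
have -> : @toRow R d @` Defs.support f = setT.
  apply/seteqP; split => // v _; exists (ofRow v); first exact: f0.
  by apply/rowP => i; rewrite mxE tnth_mktuple.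
by move=> cf; apply/continuous_subspace_setT; exact: cf.
Qed.

Definition tent_prod (r : R) (c : 'I_d -> R) : Theta -> R :=
  fun z => \prod_i tent r (tnth z i - c i).

Lemma tent_prod_ge0 r c z : 0 <= tent_prod r c z.
Proof. by apply: prodr_ge0 => i _; exact: tent_ge0. Qed.

Lemma tent_prod_notin r c z : ~ cube c r z -> tent_prod r c z = 0.
Proof.
move=> /existsNP[i /negP]; rewrite -leNgt => h.
apply/eqP/prodf_eq0; exists i => //; apply/eqP; apply: contraPP h => /eqP.
by move=> /tent_neq0; rewrite ltNge => /negP.
Qed.

Lemma tent_prod_continuous r c : Rd_continuous (tent_prod r c).
Proof.
move=> v; rewrite /tent_prod /=.
have mc : continuous (fun x : R * R => x.1 * x.2).
  by move=> [a b]; apply: cvgM; [exact: cvg_fst|exact: cvg_snd].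
pose F i (w : 'rV[R]_d) := tent r (tnth (ofRow w) i - c i).
apply: (@cvg_big R 'I_d *%R 1 xpredT mc _ (nbhs v) (index_enum 'I_d) F
  (fun i => F i v)).
move=> i _; rewrite /F; under eq_cvg do rewrite tnth_mktuple; rewrite tnth_mktuple.
apply: (@cvg_comp _ _ _ (fun v : 'rV[R]_d => v ord0 i - c i) (tent r)).
  by apply: cvgB; [exact: coord_continuous|exact: cvg_cst].
exact: continuous_tent.
Qed.

Lemma tent_prod_bounded r c : 0 < r ->
  exists M : R, forall z, `|tent_prod r c z| <= M.
Proof.
move=> r0; exists (\prod_(i < d) r) => z; rewrite ger0_norm ?tent_prod_ge0//.
by apply: ler_prod => i _; rewrite tent_ge0 tent_le.
Qed.

Lemma lebesgue_int_tent_prod r J k c : 0 <= k ->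
  (\int[@lebesgue_measure R]_t (tent r t)%:E = J%:E)%E ->
  lebesgue_int (fun z => (k * tent_prod r c z)%:E) = (k * J ^+ d)%:E.
Proof.
move=> k0 HJ; have := leb_int_prod_tent r J d 1 k c ltr01 k0 HJ.
rewrite invr1 mul1r => <-; congr leb_int; apply/funext => z; congr (_ * _)%:E.
by apply: eq_bigr => i _; rewrite mul1r.
Qed.

(** The factor [s ^+ d] offsets the Jacobian, so the value is the same for every scale and can be
    compared with the limit. *)
Lemma lebesgue_int_tent_prod_scale r J k c s : 0 <= k -> 0 < s ->
  (\int[@lebesgue_measure R]_t (tent r t)%:E = J%:E)%E ->
  lebesgue_int (fun z => (k * s ^+ d * tent_prod r c (scale s z))%:E) =
  (k * J ^+ d)%:E.
Proof.
move=> k0 s0 HJ.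
have ks : 0 <= k * s ^+ d by rewrite mulr_ge0// exprn_ge0// ltW.
have := leb_int_prod_tent r J d s _ c s0 ks HJ.
rewrite exprMn mulrA -(mulrA k) -exprMn divff ?gt_eqF// expr1n mulr1 => <-.
congr leb_int; apply/funext => z; congr (_ * _)%:E.
by apply: eq_bigr => i _; rewrite tnth_mktuple.
Qed.

Variables (phin : nat -> Theta -> R) (s : nat -> R) (phi : Theta -> R).
Hypothesis phin_ge0 : forall n x, 0 <= phin n x.
Hypothesis s_gt0 : forall n, 0 < s n.
Hypothesis phi_gt0 : forall x, 0 < phi x.
Hypothesis phi_cont : Rd_continuous phi.
Hypothesis phin_logc : forall n, log_concave (phin n).
Hypothesis phin_cvg : scaled_conv_in_distribution phin s phi.

(* The Lebesgue density of [s n *: X] for [X] of density [phin n]. *)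
Definition rescaled n x : R := (s n)^-1 ^+ d * phin n (scale (s n)^-1 x).

Let phinE n x : phin n x = s n ^+ d * rescaled n (scale (s n) x).
Proof.
rewrite /rescaled mulrA -exprMn divff ?gt_eqF// expr1n mul1r.
have sn : (s n)^-1 != 0 by rewrite invr_eq0 gt_eqF.
by have := @scaleK R d _ sn x; rewrite invrK => ->.
Qed.

Lemma rescaled_ge0 n x : 0 <= rescaled n x.
Proof. by rewrite mulr_ge0// exprn_ge0// invr_ge0 ltW. Qed.

Lemma rescaled_log_concave n : log_concave (rescaled n).
Proof. apply: log_concaveZ => [x||]; first exact: phin_ge0.
  by rewrite exprn_ge0// invr_ge0 ltW.
exact: log_concave_scale. Qed.

(** If [rescaled n] stayed below [b] on the cube, the integral of the tent product against it would
    be at most [b * J ^+ d], but these integrals tend to at least [a * J ^+ d]. *)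
Lemma near_rescaled_ge c (r a b : R) : 0 < r -> 0 <= b < a ->
  (forall z, cube c r z -> a <= phi z) ->
  \forall n \near \oo, exists2 q, cube c r q & b <= rescaled n q.
Proof.
move=> r0 /andP[b0 ba] aphi; have [J J0 HJ] := integral_tent r r0.
have a0 := le_trans b0 (ltW ba).
have lim_gt : ((b * J ^+ d)%:E <
    lebesgue_int (fun z => (tent_prod r c z * phi z)%:E))%E.
  apply: (@lt_le_trans _ _ (a * J ^+ d)%:E).
    by rewrite lte_fin ltr_pM2r// exprn_gt0.
  rewrite -(lebesgue_int_tent_prod r J a c a0 HJ).
  apply: ge0_le_leb_int => z; rewrite lee_fin.
    by rewrite mulr_ge0 ?tent_prod_ge0.
  have [cz|cz] := pselect (cube c r z); last first.
    by rewrite tent_prod_notin// mulr0 mul0r.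
  by rewrite mulrC ler_wpM2l ?tent_prod_ge0 ?aphi.
have := phin_cvg _ (tent_prod_continuous r c) (tent_prod_bounded r c r0).
move=> /cvge_near_gt /(_ lim_gt); apply: filterS => n /= H; apply: contrapT => nex.
have lt q : cube c r q -> rescaled n q <= b.
  move=> cq; rewrite leNgt; apply/negP => bq; apply: nex.
  by exists q => //; exact: ltW.
move: H; rewrite ltNge => /negP; apply.
rewrite -(lebesgue_int_tent_prod_scale r J b c (s n) b0 (s_gt0 n) HJ).
apply: ge0_le_leb_int => z; rewrite lee_fin.
  by rewrite mulr_ge0 ?tent_prod_ge0.
have [cz|cz] := pselect (cube c r (scale (s n) z)); last first.
  by rewrite tent_prod_notin// mulr0 mul0r.
rewrite mulrC ler_wpM2r ?tent_prod_ge0// phinE mulrC.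
by rewrite ler_wpM2r ?lt// exprn_ge0// ltW.
Qed.

(** The same test integral, with the inequalities reversed. *)
Lemma near_rescaled_le c (r a b : R) : 0 < r -> 0 <= a < b ->
  (forall z, cube c r z -> phi z <= a) ->
  \forall n \near \oo, exists2 q, cube c r q & rescaled n q <= b.
Proof.
move=> r0 /andP[a0 ab] aphi; have [J J0 HJ] := integral_tent r r0.
have b0 := le_trans a0 (ltW ab).
have lim_lt : (lebesgue_int (fun z => (tent_prod r c z * phi z)%:E) <
    (b * J ^+ d)%:E)%E.
  apply: (@le_lt_trans _ _ (a * J ^+ d)%:E); last first.
    by rewrite lte_fin ltr_pM2r// exprn_gt0.
  rewrite -(lebesgue_int_tent_prod r J a c a0 HJ).
  apply: ge0_le_leb_int => z; rewrite lee_fin.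
    by rewrite mulr_ge0 ?tent_prod_ge0// ltW.
  have [cz|cz] := pselect (cube c r z); last first.
    by rewrite tent_prod_notin// mulr0 mul0r.
  by rewrite mulrC ler_wpM2r ?tent_prod_ge0 ?aphi.
have := phin_cvg _ (tent_prod_continuous r c) (tent_prod_bounded r c r0).
move=> /cvge_near_lt /(_ lim_lt); apply: filterS => n /= H; apply: contrapT => nex.
have lt q : cube c r q -> b <= rescaled n q.
  move=> cq; rewrite leNgt; apply/negP => bq; apply: nex.
  by exists q => //; exact: ltW.
move: H; rewrite ltNge => /negP; apply.
rewrite -(lebesgue_int_tent_prod_scale r J b c (s n) b0 (s_gt0 n) HJ).
apply: ge0_le_leb_int => z; rewrite lee_fin.
  by rewrite !mulr_ge0 ?tent_prod_ge0// exprn_ge0// ltW.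
have [cz|cz] := pselect (cube c r (scale (s n) z)); last first.
  by rewrite tent_prod_notin// mulr0 mul0r.
rewrite [leRHS]mulrC ler_wpM2r ?tent_prod_ge0// phinE mulrC.
by rewrite ler_wpM2l ?lt// exprn_ge0// ltW.
Qed.

(* Quasi-concavity: [y] is in the convex hull of any choice of one point near
   each corner of the cube of radius [r]. *)
Lemma near_rescaled_cube_ge x (r a b : R) : 0 < r -> 0 <= b < a ->
  (forall z, cube (tnth x) r z -> a <= phi z) ->
  \forall n \near \oo, forall y, cube (tnth x) (r / 3) y -> b <= rescaled n y.
Proof.
move=> r0 ba aphi; have r3 : 0 < r / 3 by rewrite divr_gt0.
(* Cubes of radius [r / 3] around these centres stay inside the cube of radius [r] and, in each
   coordinate, lie beyond the whole inner cube of radius [r / 3]. *)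
pose c (o : {ffun 'I_d -> bool}) i : R :=
  if o i then tnth x i + 2 * (r / 3) else tnth x i - 2 * (r / 3).
have corner o : \forall n \near \oo,
    exists2 q, cube (c o) (r / 3) q & b <= rescaled n q.
  apply: (near_rescaled_ge _ _ a) => // z cz; apply: aphi => i.
  have := cz i; rewrite /c !ltr_norml; case: ifP => _ /andP[h1 h2];
  by apply/andP; split; lra.
(* There are finitely many corners, so one rank serves them all. *)
have corners : \forall n \near \oo, forall o,
    exists2 q, cube (c o) (r / 3) q & b <= rescaled n q.
  exact: filter_forall.
apply: filterS corners => n H y yr.
apply: (convex_meets_orthants [set z | b <= rescaled n z]).
  exact: (log_concave_superlevel _ _ (rescaled_ge0 n) (rescaled_log_concave n)).
move=> o; have [q cq bq] := H o; exists q => // i.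
have := cq i; have := yr i; rewrite /c !ltr_norml.
by case: ifP => _ /andP[h1 h2] /andP[h3 h4]; lra.
Qed.

Lemma rescaled_cvg x : rescaled n x @[n --> \oo] --> phi x.
Proof.
set a := phi x; have a0 : 0 < a := phi_gt0 x.
(* The 8 comes from [(1 + t) ^+ 2 <= (1 + 8 * t) * (1 - t)], valid for these [t]; the left side is
   the squared bound at [q], and [1 - t] is divided out at the end. *)
suff bd (t : R) : 0 < t <= 2^-1 -> \forall n \near \oo,
    a * (1 - t) <= rescaled n x <= a * (1 + 8 * t).
  apply/cvgrPdist_lt => e e0.
  pose t := Num.min 2^-1 (e / (16 * a)).
  have ea : 0 < e / (16 * a) by rewrite divr_gt0// mulr_gt0.
  have t01 : 0 < t <= 2^-1 by rewrite /t lt_min ge_min lexx ea andbT; lra.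
  have te : t * (16 * a) <= e.
    by rewrite -ler_pdivlMr ?mulr_gt0// /t ge_min lexx orbT.
  apply: filterS (bd t t01) => n /andP[h1 h2]; rewrite ltr_norml.
  by apply/andP; split; nra.
move=> /andP[t0 t1].
(* Controlling [phi] to half the tolerance leaves the strict gaps [lo] and [hi] demanded by the
   previous lemmas. *)
have at0 : 0 < a * t / 2 by rewrite divr_gt0// mulr_gt0.
have [r r0 rphi] := Rd_continuous_cube phi x _ phi_cont at0.
have lo : 0 <= a * (1 - t) < a * (1 - t / 2) by apply/andP; split; nra.
have hi : 0 <= a * (1 + t / 2) < a * (1 + t) by apply/andP; split; nra.
(* Reflecting [x] through [q] doubles the distance, so [r / 6] keeps the reflection in the cube of
   radius [r / 3] where the lower bound holds. *)
have r6 : 0 < r / 6 by rewrite divr_gt0.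
have r36 z : cube (tnth x) (r / 6) z -> cube (tnth x) r z.
  by move=> cz i; apply: lt_trans (cz i) _; lra.
have phi_lo z : cube (tnth x) r z -> a * (1 - t / 2) <= phi z.
  by move=> /rphi; rewrite -/a ltr_norml => /andP[h1 h2]; lra.
have phi_hi z : cube (tnth x) (r / 6) z -> phi z <= a * (1 + t / 2).
  by move=> /r36/rphi; rewrite -/a ltr_norml => /andP[h1 h2]; lra.
have N1 := near_rescaled_cube_ge x r _ _ r0 lo phi_lo.
have N2 := near_rescaled_le _ _ _ _ r6 hi phi_hi.
apply: filterS2 N1 N2 => n H [q cq qle].
have xlo : a * (1 - t) <= rescaled n x.
  by apply: H => i; rewrite subrr normr0 divr_gt0.
rewrite xlo /=.
(* Weight 2 extrapolates: this is the reflection of [x] through [q]. *)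
pose q' := cvx 2 q x.
have q'lo : a * (1 - t) <= rescaled n q'.
  apply: H => i; rewrite tnth_mktuple; have := cq i.
  rewrite !ltr_norml => /andP[h1 h2].
  by apply/andP; split; lra.
have qE : cvx 2^-1 x q' = q.
  by apply: eq_from_tnth => i; rewrite !tnth_mktuple; field.
have := log_concave_midpoint _ x q' (rescaled_ge0 n) (rescaled_log_concave n).
rewrite qE; move: xlo q'lo qle (rescaled_ge0 n q); move/andP: lo => [lo0 _].
move: (rescaled n x) (rescaled n q') (rescaled n q) => u v w ulo vlo whi w0 uv.
have w2 : w ^+ 2 <= (a * (1 + t)) ^+ 2 by rewrite ler_pXn2r// nnegrE// (le_trans w0).
have u1 : u * (a * (1 - t)) <= (a * (1 + t)) ^+ 2.
  by apply: le_trans w2; apply: le_trans uv; rewrite ler_wpM2l// (le_trans lo0).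
have at1 : 0 < a * (1 - t) by nra.
rewrite -(ler_pM2r at1); apply: le_trans u1 _.
have -> : (a * (1 + t)) ^+ 2 = a ^+ 2 * (1 + t) ^+ 2 by ring.
have -> : a * (1 + 8 * t) * (a * (1 - t)) = a ^+ 2 * ((1 + 8 * t) * (1 - t)) by ring.
by rewrite ler_pM2l ?exprn_gt0//; nra.
Qed.

End pointwise_convergence.

(** * Metropolis-Hastings chains *)

Section acceptance.
Context {R : realType} {d : nat}.
Local Notation Theta := (d.-tuple R).
Implicit Types (f g : Theta -> R) (x y : Theta).

Lemma accept_ge0 g x y : (forall z, 0 <= g z) -> 0 <= accept g x y.
Proof.
by move=> g0; rewrite /accept; case: ifP => // _; rewrite le_min ler01 divr_ge0.
Qed.

Lemma accept_le1 g x y : accept g x y <= 1.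
Proof. by rewrite /accept; case: ifP => // _; rewrite ge_min lexx. Qed.

(** Only the ratio of target values enters, so a normalising constant such as a Jacobian drops
    out. *)
Lemma acceptZ (k : R) g x y : 0 < k ->
  accept (fun z => k * g z) x y = accept g x y.
Proof.
move=> k0; rewrite /accept mulf_eq0 gt_eqF//=; case: ifP => // _.
by rewrite -mulf_div divff ?gt_eqF// mul1r.
Qed.

Lemma measurable_accept g : (forall z, 0 <= g z) -> measurable_fun setT g ->
  measurable_fun setT (fun w : Theta * Theta => accept g w.1 w.2).
Proof.
move=> g0 mg; have m1 : measurable_fun setT (fun w : Theta * Theta => g w.1).
  exact: measurableT_comp.
have m2 : measurable_fun setT (fun w : Theta * Theta => g w.2).
  exact: measurableT_comp.
apply: measurable_fun_ifT => //; first exact: measurable_fun_eqr.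
apply: measurable_minr => //; apply: measurable_funM => //.
(* On nonnegative reals the inverse is the power of exponent -1, which is measurable. *)
under eq_fun do rewrite -powR_inv1//.
exact: (measurableT_comp (measurable_powR (-1)) m1).
Qed.

Lemma accept_cvg (gn : nat -> Theta -> R) g x y : 0 < g x ->
  (forall z, gn n z @[n --> \oo] --> g z) ->
  accept (gn n) x y @[n --> \oo] --> accept g x y.
Proof.
move=> gx gng; rewrite {2}/accept gt_eqF//.
(* Eventually the denominator is positive, which excludes the conventional branch of [accept]. *)
have near0 : \forall n \near \oo, 0 < gn n x by exact: (cvgr_gt (g x)).
apply: (@cvg_trans _ ((fun n => Num.min 1 (gn n y / gn n x)) @ \oo)).
  apply: near_eq_cvg; apply: filterS near0 => n n0.
  by rewrite /accept gt_eqF.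
have mc : continuous (fun a : R => Num.min 1 a).
  move=> a; apply: (@continuous_min R R (cst 1) id); first exact: cvg_cst.
  exact: cvg_id.
apply: (@cvg_comp _ _ _ (fun n => gn n y / gn n x) (fun a => Num.min 1 a)
  _ _ _ _ (mc _)).
by apply: cvgM => //; apply: cvgV => //; rewrite gt_eqF.
Qed.

End acceptance.

(** * Kernels with an additional parameter *)

Section lifted_kernel.
Context {d1 d2 d3} {U : measurableType d1} {X : measurableType d2}
  {Y : measurableType d3} {R : realType}.
Variable L : R.-pker X ~> Y.

(** [L] seen as a kernel on [U * X] that ignores the parameter, so that integrands may depend on
    both components. *)
Definition kernel_snd (u : U * X) : {measure set Y -> \bar R} := L u.2.

Let measurable_kernel_snd A : measurable A ->
  measurable_fun setT (kernel_snd ^~ A).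
Proof.
move=> mA; exact: (measurableT_comp (measurable_kernel L A mA) measurable_snd).
Qed.

HB.instance Definition _ :=
  isKernel.Build _ _ (U * X)%type Y R kernel_snd measurable_kernel_snd.

Let kernel_snd_prob u : kernel_snd u setT = 1%E.
Proof. exact: prob_kernel. Qed.

HB.instance Definition _ :=
  Kernel_isProbability.Build _ _ (U * X)%type Y R kernel_snd kernel_snd_prob.

Lemma measurable_fun_integral_snd (k : (U * X) * Y -> \bar R) :
  measurable_fun setT k -> (forall w, 0 <= k w)%E ->
  measurable_fun setT (fun u : U * X => \int[L u.2]_y k (u, y))%E.
Proof.
move=> mk k0; exact: (measurable_fun_integral_finite_kernel k kernel_snd k0 mk).
Qed.

End lifted_kernel.

(** * Path expectations: bounds, measurability, limits and rescaling *)

Section metropolis_hastings.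
Context {R : realType} {d : nat}.
Local Notation Theta := (d.-tuple R).
Variable L : R.-pker Theta ~> Theta.
Local Open Scope ereal_scope.

(** This bound keeps the extended-real sums and products finite and supplies the constant 1 as
    dominating function. *)
Definition in01 {T} (F : T -> \bar R) := forall w, 0 <= F w <= 1.

Lemma in01_fin_num {T} (F : T -> \bar R) w : in01 F -> F w \is a fin_num.
Proof.
move=> /(_ w) /andP[F0 F1].
by rewrite ge0_fin_numE//; exact: le_lt_trans F1 (ltry _).
Qed.

Lemma integral_accept_in01 (g : Theta -> R) x : (forall z, 0 <= g z)%R ->
  0 <= \int[L x]_y (accept g x y)%:E <= 1.
Proof.
move=> g0; apply/andP; split.
  by apply: integral_ge0 => y _; rewrite lee_fin accept_ge0.
apply: (@le_trans _ _ (\int[L x]_y (cst 1 y))).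
  by apply: ge0_le_integralT => y; rewrite lee_fin ?accept_ge0// accept_le1.
by rewrite integral_cst// mul1e prob_kernel lexx.
Qed.

(** Replacing [h] by 1 turns the two terms into the probabilities of moving and of staying, which
    add up to 1. *)
Lemma MHint_in01 (g : Theta -> R) h : (forall z, 0 <= g z)%R -> in01 h ->
  in01 (fun x => MHint (Lint L) g x h).
Proof.
move=> g0 h01 x; rewrite /MHint /Lint.
have /andP[a0 a1] := integral_accept_in01 g x g0.
have afin : \int[L x]_y (accept g x y)%:E \is a fin_num.
  by rewrite ge0_fin_numE//; exact: le_lt_trans a1 (ltry _).
have /andP[hx0 hx1] := h01 x.
have r0 : 0 <= 1 - \int[L x]_y (accept g x y)%:E 
  by rewrite -(fineK afin) -EFinB lee_fin subr_ge0 -lee_fin fineK.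
have i0 y : 0 <= (accept g x y)%:E * h y.
  by rewrite mule_ge0 ?lee_fin ?accept_ge0//; have /andP[] := h01 y.
apply/andP; split.
  by rewrite adde_ge0 ?mule_ge0//; apply: integral_ge0 => y _; exact: i0.
apply: (@le_trans _ _ (\int[L x]_y (accept g x y)%:E +
    (1 - \int[L x]_y (accept g x y)%:E))); last by rewrite addeC subeK.
apply: leeD; last by rewrite -[leRHS]mule1 lee_pmul.
apply: ge0_le_integralT => // y; rewrite -[leRHS]mule1 lee_pmul//.
- by rewrite lee_fin accept_ge0.
- by have /andP[] := h01 y.
- by have /andP[] := h01 y.
Qed.

Lemma pathE_in01 (g : Theta -> R) T (F : T.+1.-tuple Theta -> \bar R) :
  (forall z, 0 <= g z)%R -> in01 F ->
  in01 (fun x => pathE (Lint L) g x F).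
Proof.
move=> g0; elim: T F => [|T IH] F F01 x /=; first exact: F01.
by apply: (MHint_in01 g _ g0) => y; apply: IH => p; exact: F01.
Qed.

(* The parameter space [U] carries the coordinates already visited. *)
Lemma measurable_pathE (g : Theta -> R) T d1 (U : measurableType d1)
    (F : U * T.+1.-tuple Theta -> \bar R) :
  (forall z, 0 <= g z)%R -> measurable_fun setT g ->
  measurable_fun setT F -> in01 F ->
  measurable_fun setT
    (fun u : U * Theta => pathE (Lint L) g u.2 (fun p => F (u.1, p))).
Proof.
move=> g0 mg; elim: T d1 U F => [|T IH] d1 U F mF F01 /=.
  apply: (measurableT_comp mF); apply: measurable_fun_pair => //.
  rewrite [X in measurable_fun _ X](_ : _ =
     fun w : U * Theta => [the 1.-tuple Theta of w.2 :: [tuple]]).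
    exact: measurable_cons.
  by apply/funext => w; apply: val_inj.
(* The current state joins the parameters: the induction hypothesis is used with parameter space
   [U * Theta]. *)
pose G (w : (U * Theta) * Theta) :=
  pathE (Lint L) g w.2 (fun p => F (w.1.1, cons_tuple w.1.2 p)).
have G01 : in01 G.
  by move=> w; apply: (pathE_in01 g _ _ g0) => p; exact: F01.
have mG : measurable_fun setT G.
  apply: (IH _ (U * Theta)%type (fun w => F (w.1.1, cons_tuple w.1.2 w.2))).
    apply: (measurableT_comp mF); apply: measurable_fun_pair.
      exact: (measurableT_comp measurable_fst measurable_fst).
    apply: measurable_cons => //.
    exact: (measurableT_comp measurable_snd measurable_fst).
  by move=> w; exact: F01.
have mA : measurable_fun setT
    (fun w : (U * Theta) * Theta => (accept g w.1.2 w.2)%:E).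
  apply/measurable_EFinP.
  apply: (@measurableT_comp _ _ _ _ _ _ (fun w : Theta * Theta => accept g w.1 w.2) _
     (fun w : (U * Theta) * Theta => (w.1.2, w.2))).
    exact: measurable_accept.
  apply: measurable_fun_pair => //.
  exact: (measurableT_comp measurable_snd measurable_fst).
rewrite /MHint /Lint.
apply: emeasurable_funD.
  apply: (measurable_fun_integral_snd L (fun w => (accept g w.1.2 w.2)%:E * G w)).
    exact: emeasurable_funM.
  move=> w; rewrite mule_ge0 ?lee_fin ?accept_ge0//.
  by have /andP[] := G01 w.
apply: emeasurable_funM.
  apply: emeasurable_funB => //.
  apply: (measurable_fun_integral_snd L (fun w => (accept g w.1.2 w.2)%:E)) => //.
  by move=> w; rewrite lee_fin accept_ge0.
(* On rejection the next state equals the current one, so [G] is taken on the diagonal. *)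
apply: (@measurableT_comp _ _ _ _ _ _ G _ (fun u => (u, u.2))) => //.
exact: measurable_fun_pair.
Qed.

Lemma measurable_pathE_cons (g : Theta -> R) T (F : T.+2.-tuple Theta -> \bar R) x :
  (forall z, 0 <= g z)%R -> measurable_fun setT g ->
  measurable_fun setT F -> in01 F ->
  measurable_fun setT
    (fun y => pathE (Lint L) g y (fun p => F (cons_tuple x p))).
Proof.
move=> g0 mg mF F01.
have := @measurable_pathE g T _ Theta (fun w => F (cons_tuple w.1 w.2)) g0 mg.
move=> H; apply: (@measurable_fun_pair2 _ _ _ Theta Theta (\bar R)
  (fun u : Theta * Theta => pathE (Lint L) g u.2 (fun p => F (cons_tuple u.1 p))) x).
apply: H; last by move=> w; exact: F01.
by apply: (measurableT_comp mF); exact: measurable_cons.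
Qed.

Lemma Lint_dominated_cvg x (hn : nat -> Theta -> \bar R) (h : Theta -> \bar R) :
  (forall n, measurable_fun setT (hn n)) -> measurable_fun setT h ->
  (forall n, in01 (hn n)) -> (forall y, hn n y @[n --> \oo] --> h y) ->
  Lint L x (hn n) @[n --> \oo] --> Lint L x h.
Proof.
move=> mhn mh hn01 hnh.
have [] := @dominated_convergence _ _ R (L x) setT measurableT hn h (cst 1) mhn mh.
- by apply: aeW => y _; exact: hnh.
- apply/integrableP; split => //.
  by rewrite (eq_integral (cst 1)) ?integral_cst ?mul1e ?prob_kernel ?ltry// => y _;
     rewrite /= normr1.
- by apply: aeW => y n _; have /andP[h0 h1] := hn01 n y; rewrite gee0_abs.
- by move=> _ _.
Qed.

(** Induction on the number of steps, freezing the current state inside [F]. Acceptance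
    probabilities and expectations of the remaining path converge pointwise within [0,1], so
    dominated convergence applies. *)
Lemma pathE_cvg (gn : nat -> Theta -> R) (g : Theta -> R) T
    (F : T.+1.-tuple Theta -> \bar R) x :
  (forall n z, 0 <= gn n z)%R -> (forall n, measurable_fun setT (gn n)) ->
  (forall z, 0 <= g z)%R -> measurable_fun setT g ->
  (forall x y, accept (gn n) x y @[n --> \oo] --> accept g x y) ->
  measurable_fun setT F -> in01 F ->
  pathE (Lint L) (gn n) x F @[n --> \oo] --> pathE (Lint L) g x F.
Proof.
move=> gn0 mgn g0 mg acc; elim: T F x => [|T IH] F x mF F01 /=; first exact: cvg_cst.
have mAc (f : Theta -> R) : (forall z, 0 <= f z)%R -> measurable_fun setT f ->
    measurable_fun setT (fun y => (accept f x y)%:E).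
  move=> f0 mf; apply/measurable_EFinP.
  apply: (@measurable_fun_pair2 _ _ _ Theta Theta R
    (fun w : Theta * Theta => accept f w.1 w.2) x).
  exact: measurable_accept.
have acvg y : (accept (gn n) x y)%:E @[n --> \oo] --> (accept g x y)%:E.
  exact/cvg_EFin/acc/nearW.
pose hn n y := pathE (Lint L) (gn n) y (fun p => F (cons_tuple x p)).
pose h y := pathE (Lint L) g y (fun p => F (cons_tuple x p)).
have hn01 n : in01 (hn n) by apply: pathE_in01 => // p; exact: F01.
have h01 : in01 h by apply: pathE_in01 => // p; exact: F01.
have hcvg y : hn n y @[n --> \oo] --> h y.
  apply: IH => [|p]; last exact: F01.
  by apply: (measurableT_comp mF); exact: measurable_cons.
have mhn n : measurable_fun setT (hn n) by exact: measurable_pathE_cons.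
have mh : measurable_fun setT h by exact: measurable_pathE_cons.
have Lfin : Lint L x (fun y => (accept g x y)%:E) \is a fin_num.
  have /andP[a0 a1] := integral_accept_in01 g x g0.
  by rewrite ge0_fin_numE//; exact: le_lt_trans a1 (ltry _).
have hfin : h x \is a fin_num by exact: in01_fin_num.
rewrite /MHint; apply: cvgeD.
- by rewrite fin_num_adde_defl// fin_numM// fin_numB Lfin.
- apply: Lint_dominated_cvg => [n||n y|y].
  + exact: (emeasurable_funM (mAc _ (gn0 n) (mgn n)) (mhn n)).
  + exact: (emeasurable_funM (mAc _ g0 mg) mh).
  + have /andP[u0 u1] := hn01 n y.
    rewrite mule_ge0 ?lee_fin ?accept_ge0//=.
    by rewrite -[leRHS]mule1 lee_pmul// lee_fin ?accept_ge0// accept_le1.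
  + apply: cvgeM; [|exact: acvg|exact: hcvg].
    by apply: mule_def_fin => //; exact: (in01_fin_num h).
- apply: cvgeM; [|idtac|exact: hcvg].
    by apply: mule_def_fin => //; rewrite fin_numB Lfin.
  apply: cvgeB => //; first exact: cvg_cst.
  apply: Lint_dominated_cvg => [n||n y|//].
  + exact: (mAc _ (gn0 n) (mgn n)).
  + exact: (mAc _ g0 mg).
  + by rewrite lee_fin accept_ge0//= lee_fin accept_le1.
Qed.

(** Multiplication by [s] turns the proposal back into [L] and the target into [f] composed with the
    inverse scaling. The constant [k] is free by [acceptZ] and can be chosen to give a density. *)
Lemma pathE_rescale (f : Theta -> R) (s k : R) T x
    (F : T.+1.-tuple Theta -> \bar R) :
  s != 0%R -> (0 < k)%R ->
  pathE (Lnint L s) f (scale s^-1 x) (fun p => F (map_tuple (scale s) p)) =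
  pathE (Lint L) (fun z => k * f (scale s^-1 z))%R x F.
Proof.
move=> s0 k0; elim: T x F => [|T IH] x F /=.
  by congr F; apply: val_inj; rewrite /= scaleK.
rewrite /MHint /Lnint /Lint scaleK//.
have E y : pathE (Lnint L s) f (scale s^-1 y)
    (fun p => F (map_tuple (scale s) (cons_tuple (scale s^-1 x) p))) =
  pathE (Lint L) (fun z => k * f (scale s^-1 z))%R y (fun p => F (cons_tuple x p)).
  rewrite -IH; congr pathE; apply/funext => p; congr F.
  by apply: val_inj; rewrite /= scaleK.
rewrite E; congr (_ + (1 - _) * _).
  apply: eq_integral => z _; rewrite E; congr (_%:E * _).
  by rewrite acceptZ.
by apply: eq_integral => z _; rewrite acceptZ.
Qed.

End metropolis_hastings.

(** * From pointwise limits to suprema over tails *)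

Lemma measurable_scale (R : realType) (d : nat) (s : R) :
  measurable_fun setT (@scale R d s).
Proof.
apply/measurable_fun_tnthP => i.
rewrite [X in measurable_fun _ X](_ : _ = fun x => s * tnth x i); last first.
  by apply/funext => x /=; rewrite tnth_mktuple.
by apply: measurable_funM => //; exact: measurable_tnth.
Qed.

Lemma Rd_compact1 (R : realType) (d : nat) (x : d.-tuple R) : Rd_compact [set x].
Proof. by rewrite /Rd_compact image_set1; exact: compact_set1. Qed.

(** The tail suprema tend to the limit superior, which is the limit when the sequence converges. *)
Lemma cvg_ereal_sup_tail (R : realType) (u : nat -> \bar R) (l : \bar R) :
  u @ \oo --> l ->
  (fun N => ereal_sup [set u n | n in [set n | (N <= n)%N]]) @ \oo --> l.
Proof.
move=> ul; have : cvgn (esups u) by exact: is_cvg_esups.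
by rewrite -limn_esup_lim (cvg_limn_einf_sup ul).2.
Qed.

Theorem mainTheorem10 (R : realType) (d : nat)
    (phin : nat -> d.-tuple R -> R) (s : nat -> R) (phi : d.-tuple R -> R)
    (L : R.-pker (d.-tuple R) ~> (d.-tuple R)) (T : nat) (x : d.-tuple R) :
  (forall n, is_density (phin n)) ->
  (forall n, 0 < s n) ->
  is_density phi ->
  (forall n, log_concave (phin n)) ->
  s n @[n --> \oo] --> +oo ->
  scaled_conv_in_distribution phin s phi ->
  continuous_on_support phi ->
  (forall X : set (d.-tuple R), Rd_compact X ->
     (0 < ereal_inf [set (phi y)%:E | y in X])%E) ->
  symmetric_kernel L ->
  forall A : set (T.+1.-tuple (d.-tuple R)), measurable A ->
  (fun N0 : nat => ereal_sup
     [set `| pathE (Lnint L (s n)) (phin n) (scale (s n)^-1 x)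
               (fun p => (\1_A (map_tuple (scale (s n)) p))%:E)
             - pathE (Lint L) phi x (fun p => (\1_A p)%:E) |%E
     | n in [set n | (N0 <= n)%N]]) @ \oo --> 0%E.
Proof.
move=> dphin s0 [_ mphi _] lc _ cv cts inf _ A mA.
have phin0 n z : 0 <= phin n z by have [] := dphin n.
(* Singletons are compact, so the infimum condition gives positivity at every point. *)
have phi0 z : 0 < phi z.
  rewrite -lte_fin; apply: lt_le_trans (inf _ (Rd_compact1 R d z)) _.
  by apply: ereal_inf_lbound; exists z.
pose F (p : T.+1.-tuple (d.-tuple R)) : \bar R := (\1_A p)%:E.
have F01 : in01 F.
  by move=> p; rewrite /F lee_fin lee_fin indicE ler0n lern1 leq_b1.
have mF : measurable_fun setT F by apply/measurable_EFinP; exact: measurable_indic.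
have pcv := rescaled_cvg phin s phi phin0 s0 phi0
  (continuous_on_support_pos phi phi0 cts) lc cv.
have mresc n : measurable_fun setT (rescaled phin s n).
  apply: measurable_funM => //; have [_ mf _] := dphin n.
  exact: (measurableT_comp mf (measurable_scale R d (s n)^-1)).
apply: cvg_ereal_sup_tail; apply/cvg_abse0P/sube_cvg0.
  exact: (in01_fin_num _ x (pathE_in01 L phi _ F (fun z => ltW (phi0 z)) F01)).
(* Taking the Jacobian for [k] makes the target exactly [rescaled]. *)
under eq_cvg => n.
  rewrite (pathE_rescale L (phin n) (s n) ((s n)^-1 ^+ d) T x F) ?gt_eqF//;
    last by rewrite exprn_gt0// invr_gt0.
  over.
apply: (pathE_cvg L (rescaled phin s)) => //.
- exact: rescaled_ge0.
- by move=> z; exact: ltW.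
- by move=> y z; exact: accept_cvg.
Qed.
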